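(* Let $\alpha\in\mathbb{R}$ and consider $E^\alpha_4(\Gamma_4)$ as a function of $\Gamma_4$, where $\Gamma_4$ ranges over all convex $4$-gons (possibly degenerate) in the plane with each edge of length $1$. Then: \begin{itemize} \item if $\alpha<2$, $E^\alpha_4$ reaches its maximum at the square $\Gamma_4^o$ of edge length $1$; \item if $\alpha>2$, $E^\alpha_4$ reaches its maximum at the double straight arc $\Gamma_4^-$; \item if $\alpha=2$, $E^2_4(\Gamma_4)$ is constant, i.e. has the same value for all $\Gamma_4$. \end{itemize}
   Context: For $\alpha\in\mathbb{R}$ define $f_\alpha:(0,\infty)\to\mathbb{R}$ by $f_\alpha(x)=x^\alpha$ if $\alpha>0$, $f_\alpha(x)=\ln x$ if $\alpha=0$, and $f_\alpha(x)=-x^\alpha$ if $\alpha<0$. The value $f_\alpha(0)$ is understood as $\lim_{x\to0^+}f_\alpha(x)$, which is $0$ if $\alpha>0$ and $-\infty$ if $\alpha\le 0$. For a polygon $\Gamma_n$ with vertices $A_1,\dots,A_n$, $E^\alpha_n(\Gamma_n)=\sum_{1\le p<q\le n} f_\alpha(|A_pA_q|)\in[-\infty,\infty)$, where $|A_pA_q|$ is the Euclidean distance. A convex $n$-gon (possibly degenerate) with each edge of length $1$ is a closed polygon in a plane with vertices $A_1,\dots,A_n$ (cyclic indices, $A_{n+1}=A_1$) with $|A_iA_{i+1}|=1$ for all $i$, such that, with $C$ the convex hull of the vertices, $A_1,\dots,A_n$ lie on the boundary closed curve $\partial C$ and occur on it in this cyclic order during a single traversal. Angles equal to $\pi$ are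 allowed. If all $A_i$ are collinear (degenerate case), $C$ is a segment and $\partial C$ is understood as that segment traversed once forth and once back. For even $n=2m$, the double straight arc $\Gamma_n^-$ is the degenerate polygon of this kind in which one of the diagonals has length $m$. For $n=4$ its vertices are, up to isometry and cyclic relabelling, at the points $0,1,2,1$ of a line, in this cyclic order. *)

(* Defs.v *)
From HB Require Import structures.
From mathcomp Require Import all_boot all_order all_algebra.
From mathcomp Require Import all_classical all_reals all_analysis.
Set Implicit Arguments.
Unset Strict Implicit.
Unset Printing Implicit Defensive.
Import Order.TTheory GRing.Theory Num.Theory.
Import numFieldNormedType.Exports.
Local Open Scope classical_set_scope.
Local Open Scope ring_scope.

Section Defs.
Context {R : realType}.

Local Notation plane := 'rV[R]_2.

(* The library norm on ['rV[R]_2] is the sup norm, which has the same topology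
   as the Euclidean distance but does not measure |PQ|. *)
Definition dist (P Q : plane) : R :=
  Num.sqrt (\sum_(k < 2) (P 0 k - Q 0 k) ^+ 2).

(* Only meant for [0 <= x]. At [x = 0] this is the limit from the right:
   [0 `^ alpha] is [0] for [0 < alpha], and [lne 0] is [-oo]; for [alpha < 0]
   the library has [0 `^ alpha = 0], hence the explicit case. *)
Definition f_energy (alpha x : R) : \bar R :=
  if 0 < alpha then (x `^ alpha)%:E
  else if alpha == 0 then lne x%:E
  else if x == 0 then -oo%E
  else (- (x `^ alpha))%:E.

Definition energy (alpha : R) (n : nat) (A : 'I_n -> plane) : \bar R :=
  (\sum_(p < n) \sum_(q < n | (p < q)%N) f_energy alpha (dist (A p) (A q)))%E.

Definition collinear (n : nat) (A : 'I_n -> plane) : Prop :=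
  exists P V : plane, forall i, exists s : R, A i = P + s *: V.

Definition hull (n : nat) (A : 'I_n -> plane) : set plane :=
  smallest (@convex_set R plane) (range A).

Definition frontier (C : set plane) : set plane := closure C `\` interior C.

(* Closed curves are parametrised by the line, with period 1: every
   [`[a, a + 1[] is a single traversal, whatever the starting point [a]. *)
Definition simple_traversal (B : set plane) (g : R -> plane) : Prop :=
  [/\ continuous g, periodic g 1, {in `[0, 1[ &, injective g} & range g = B].

Definition forth_and_back_traversal (S : set plane) (g : R -> plane) : Prop :=
  [/\ continuous g, periodic g 1 &
    exists a b : R, [/\ a < b < a + 1,
      {in `[a, b] &, injective g}, g @` `[a, b] = S,
      {in `[b, a + 1] &, injective g} & g @` `[b, a + 1] = S]].

Definition boundary_traversal (n : nat) (A : 'I_n -> plane) (g : R -> plane) :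
    Prop :=
  (~ collinear A -> simple_traversal (frontier (hull A)) g) /\
  (collinear A -> forth_and_back_traversal (hull A) g).

Definition occur_in_cyclic_order (n : nat) (A : 'I_n -> plane) (g : R -> plane) :
    Prop :=
  exists t : 'I_n -> R,
    [/\ forall i, A i = g (t i),
        forall i j : 'I_n, (i <= j)%N -> t i <= t j &
        forall i j : 'I_n, t j < t i + 1].

Definition unit_edges (n : nat) (A : 'I_n -> plane) : Prop :=
  forall i : 'I_n, dist (A i) (A (ordS i)) = 1.

Definition convex_unit_polygon (n : nat) (A : 'I_n -> plane) : Prop :=
  unit_edges A /\
  exists g : R -> plane, boundary_traversal A g /\ occur_in_cyclic_order A g.

Definition unit_square (A : 'I_4 -> plane) : Prop :=
  unit_edges A /\
  forall i : 'I_4,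
    \sum_(k < 2) (A (ordS i) 0 k - A i 0 k) *
                 (A (ordS (ordS i)) 0 k - A (ordS i) 0 k) = 0.

Definition double_straight_arc (m : nat) (A : 'I_(m.*2) -> plane) : Prop :=
  [/\ convex_unit_polygon A, collinear A &
      exists i j : 'I_(m.*2), dist (A i) (A j) = m%:R].

(* [P] singles out a polygon up to isometry and relabelling; the first
   conjunct says that there is one. *)
Definition reaches_max_at (n : nat) (E : ('I_n -> plane) -> \bar R)
    (P : ('I_n -> plane) -> Prop) : Prop :=
  (exists S, P S) /\
  forall S, P S -> convex_unit_polygon S /\
    forall G, convex_unit_polygon G -> (E G <= E S)%E.

End Defs.

(* Main.v *)
(** If the unit edges are p, q, r, -(p+q+r), then p.q + q.r + p.r = -1, so
    both diagonals p+q and q+r are orthogonal to each other and to p+r. In the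
    plane this forces p+r = 0 (a rhombus) unless a diagonal vanishes. Cyclic
    order on the boundary rules out the remaining polygons except the double
    straight arc, because a closed boundary curve passes through a vertex of
    the hull once per period. Hence the squared diagonals always add up to 4,
    and the energy is a constant plus f(x) + f(y) with x^2 + y^2 = 4, which is
    settled by convexity of powers. Conversely a nondegenerate rhombus with
    half-diagonals u, v and centre c has as hull the unit ball of the l1 norm
    in the basis (u, v), whose boundary is traversed by
    c + cos a |cos a| u + sin a |sin a| v. *)
Require Import Defs.
From mathcomp Require Import all_boot all_order all_algebra.
From mathcomp Require Import ring lra.
From mathcomp Require Import all_classical all_reals all_analysis.
Set Implicit Arguments.
Unset Strict Implicit.
Unset Printing Implicit Defensive.
Import Order.TTheory GRing.Theory Num.Theory.
Import numFieldNormedType.Exports.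
Local Open Scope classical_set_scope.
Local Open Scope ring_scope.

(** * Inequalities for two nonnegative numbers whose squares add up to 4 *)

Lemma powR_sum_le_concave (R : realType) (alpha x y : R) :
  0 < alpha -> alpha <= 2 -> 0 <= x -> 0 <= y -> x ^+ 2 + y ^+ 2 = 4 ->
  x `^ alpha + y `^ alpha <= Num.sqrt 2 `^ alpha + Num.sqrt 2 `^ alpha.
Proof.
move=> a0 a2 x0 y0 xy.
have p1 : 1 <= 2 / alpha by rewrite ler_pdivlMr// mul1r.
have powK z : 0 <= z -> (z `^ alpha) `^ (2 / alpha) = z ^+ 2.
  by move=> z0; rewrite -powRrM mulrC divfK ?gt_eqF// powR_mulrn.
have half : (2^-1 : R) = 1 - 2^-1 by rewrite [X in X - _](splitr 1) div1r addrK.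
have le_pow : (2^-1 * x `^ alpha + 2^-1 * y `^ alpha) `^ (2 / alpha) <=
    (Num.sqrt 2 `^ alpha) `^ (2 / alpha).
  apply: (@le_trans _ _ (2^-1 * (x `^ alpha) `^ (2 / alpha) +
                         2^-1 * (y `^ alpha) `^ (2 / alpha))).
    (* Convexity is stated with weights t and 1 - t, so the second weight on each side is put in
       that form. *)
    rewrite {2 4}half.
    by apply: (convex_powR p1 (Itv01 _ _)) => //=;
      rewrite ?inE/= ?in_itv/= ?powR_ge0// ?invr_ge0// invf_le1 ?ler1n.
  by rewrite !powK ?sqrtr_ge0// sqr_sqrtr// -mulrDr xy; lra.
have le_avg : 2^-1 * x `^ alpha + 2^-1 * y `^ alpha <= Num.sqrt 2 `^ alpha.
  rewrite leNgt; apply/negP => /(gt0_ltr_powR (lt_le_trans ltr01 p1)).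
  rewrite !nnegrE powR_ge0 addr_ge0 ?mulr_ge0 ?powR_ge0// => /(_ isT isT).
  by rewrite ltNge le_pow.
lra.
Qed.

(** AM-GM twice: xy <= 2, so for a negative exponent (xy)^alpha >= 2^alpha, and then u + v is at
    least twice the square root of uv for u = x^alpha and v = y^alpha. *)
Lemma powR_sum_ge_convex (R : realType) (alpha x y : R) :
  alpha < 0 -> 0 < x -> 0 < y -> x ^+ 2 + y ^+ 2 = 4 ->
  Num.sqrt 2 `^ alpha + Num.sqrt 2 `^ alpha <= x `^ alpha + y `^ alpha.
Proof.
move=> a0 x0 y0 xy.
have s2 : Num.sqrt 2 ^+ 2 = 2 :> R by rewrite sqr_sqrtr.
have prod_ge : (Num.sqrt 2 `^ alpha) ^+ 2 <= x `^ alpha * y `^ alpha.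
  rewrite expr2 -!powRM ?sqrtr_ge0 ?(ltW x0) ?(ltW y0)// -expr2 s2.
  have xy2 : x * y <= 2 by have := sqr_ge0 (x - y); nra.
  rewrite -[alpha]opprK !(powRN _ (- alpha)) lef_pV2 ?posrE ?powR_gt0 ?mulr_gt0//.
  apply: ge0_ler_powR => //; rewrite ?oppr_ge0 ?nnegrE ?mulr_ge0 ?(ltW x0) ?(ltW y0) ?(ltW a0) //.
have := powR_gt0 alpha x0; have := powR_gt0 alpha y0.
have : 0 < Num.sqrt 2 `^ alpha by apply: powR_gt0; rewrite sqrtr_gt0.
move: prod_ge; move: (Num.sqrt 2 `^ alpha) (x `^ alpha) (y `^ alpha) => s u v.
move=> suv s0 v0 u0.
rewrite -(@ler_sqr R) ?nnegrE ?addr_ge0 ?(ltW s0) ?(ltW u0) ?(ltW v0)//.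
have := sqr_ge0 (u - v); nra.
Qed.

(** For z in [0, 2] the ratio z/2 is at most 1, so (z/2)^alpha <= (z/2)^2 when alpha >= 2. Summing
    over x and y gives the factor (x^2 + y^2)/4 = 1. *)
Lemma powR_sum_le_superadd (R : realType) (alpha x y : R) :
  2 <= alpha -> 0 <= x -> 0 <= y -> x ^+ 2 + y ^+ 2 = 4 ->
  x `^ alpha + y `^ alpha <= 2 `^ alpha.
Proof.
move=> a2 x0 y0 xy.
have pow_le z : 0 <= z -> z ^+ 2 <= 4 -> z `^ alpha <= 2 `^ alpha * (z ^+ 2 / 4).
  move=> z0 z4.
  have -> : z `^ alpha = 2 `^ alpha * (z / 2) `^ alpha.
    by rewrite -powRM ?divr_ge0// mulrC divfK.
  rewrite ler_pM2l ?powR_gt0//.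
  have [->|zn0] := eqVneq z 0.
    by rewrite mul0r powR0 ?gt_eqF ?expr0n ?mul0r ?mulr0//; lra.
  have zp : 0 < z by rewrite lt_def zn0.
  have -> : z ^+ 2 / 4 = (z / 2) `^ 2%:R by rewrite powR_mulrn ?divr_ge0//; field.
  apply: ger_powR => //; rewrite divr_gt0//=; nra.
have := pow_le _ x0; have := pow_le _ y0.
move=> /(_ ltac:(nra)) hy /(_ ltac:(nra)) hx.
have : 2 `^ alpha = 2 `^ alpha * (x ^+ 2 / 4) + 2 `^ alpha * (y ^+ 2 / 4).
  by rewrite -mulrDr -mulrDl xy divff ?mulr1.
lra.
Qed.

Lemma ln_sum_le (R : realType) (x y : R) :
  0 < x -> 0 < y -> x ^+ 2 + y ^+ 2 = 4 ->
  ln x + ln y <= ln (Num.sqrt 2) + ln (Num.sqrt 2).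
Proof.
move=> x0 y0 xy.
rewrite -!lnM ?posrE ?sqrtr_gt0// -expr2 sqr_sqrtr//.
by rewrite ler_ln ?posrE ?mulr_gt0//; have := sqr_ge0 (x - y); nra.
Qed.

(** For alpha <= 0 a vanishing diagonal makes the left side -oo, so the real inequalities are needed
    only for positive diagonals. *)
Lemma f_energy_diag_le_square (R : realType) (alpha x y : R) :
  alpha < 2 -> 0 <= x -> 0 <= y -> x ^+ 2 + y ^+ 2 = 4 ->
  (f_energy alpha x + f_energy alpha y <=
   f_energy alpha (Num.sqrt 2) + f_energy alpha (Num.sqrt 2))%E.
Proof.
move=> a2 x0 y0 xy; rewrite /f_energy.
have s2 : 0 < Num.sqrt 2 :> R by rewrite sqrtr_gt0.
have sgt z : 0 <= z -> z != 0 -> 0 < z :> R by move=> z0 zn; rewrite lt_def zn.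
have [a0|a0|a0] := ltgtP 0 alpha.
- by rewrite -!EFinD lee_fin; apply: powR_sum_le_concave => //; exact: ltW.
- rewrite (gt_eqF s2).
  have [_|xn0] := eqVneq x 0; first by rewrite addNye leNye.
  have [_|yn0] := eqVneq y 0; first by rewrite addeNy leNye.
  rewrite -!EFinD lee_fin -!opprD lerN2.
  by apply: powR_sum_ge_convex => //; exact: sgt.
- have [->|xn0] := eqVneq x 0; first by rewrite (le0_lneNy (lexx 0%E)) addNye leNye.
  have [->|yn0] := eqVneq y 0; first by rewrite (le0_lneNy (lexx 0%E)) addeNy leNye.
  by rewrite !lne_EFin ?sgt// -!EFinD lee_fin ln_sum_le ?sgt.
Qed.

Lemma f_energy_diag_le_segment (R : realType) (alpha x y : R) :
  2 <= alpha -> 0 <= x -> 0 <= y -> x ^+ 2 + y ^+ 2 = 4 ->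
  (f_energy alpha x + f_energy alpha y <= f_energy alpha 2 + f_energy alpha 0)%E.
Proof.
move=> a2 x0 y0 xy; have a0 : 0 < alpha by lra.
rewrite /f_energy a0 powR0 ?gt_eqF// adde0 -EFinD lee_fin.
exact: powR_sum_le_superadd.
Qed.

Lemma f_energy2 (R : realType) (x : R) : 0 <= x -> f_energy 2 x = (x ^+ 2)%:E.
Proof. by move=> x0; rewrite /f_energy ltr0n /= powR_mulrn. Qed.

(** * Splitting the energy into edges and diagonals *)

Lemma sum_ord4_pairs (R : realType) (F : 'I_4 -> 'I_4 -> \bar R) :
  (\sum_(p < 4) \sum_(q < 4 | (p < q)%N) F p q =
   F 0%R 1%R + F 0%R 2%R + F 0%R 3%R + F 1%R 2%R + F 1%R 3%R + F 2%R 3%R)%E.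
Proof.
under eq_bigr => p _ do rewrite big_mkcond !big_ord_recl big_ord0.
rewrite !big_ord_recl big_ord0.
have -> : lift ord0 (lift ord0 (lift ord0 ord0)) = 3%R :> 'I_4 by exact: val_inj.
have -> : lift ord0 (lift ord0 ord0) = 2%R :> 'I_4 by exact: val_inj.
have -> : lift ord0 ord0 = 1%R :> 'I_4 by exact: val_inj.
have -> : ord0 = 0%R :> 'I_4 by exact: val_inj.
by rewrite /= !add0r !addr0 !addrA.
Qed.

Lemma ord4P (i : 'I_4) : [\/ i = 0, i = 1, i = 2 | i = 3].
Proof.
by case: i => [[|[|[|[|//]]]]] ?; [apply: Or41|apply: Or42|apply: Or43|apply: Or44];
  exact: val_inj.
Qed.

Lemma ordS4 :
  [/\ ordS 0 = 1 :> 'I_4, ordS 1 = 2 :> 'I_4, ordS 2 = 3 :> 'I_4 &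
      ordS 3 = 0 :> 'I_4].
Proof. by split; exact: val_inj. Qed.

Lemma distC (R : realType) (P Q : 'rV[R]_2) : dist P Q = dist Q P.
Proof. by rewrite /dist; congr Num.sqrt; apply: eq_bigr => k _; rewrite -sqrrN opprB. Qed.

(** The four edge terms do not depend on the polygon, so comparing energies amounts to comparing the
    bracketed diagonal terms. *)
Lemma energy_unit_edges (R : realType) (alpha : R) (A : 'I_4 -> 'rV[R]_2) :
  unit_edges A ->
  energy alpha A = (f_energy alpha 1 + f_energy alpha 1 +
     f_energy alpha 1 + f_energy alpha 1 +
    (f_energy alpha (dist (A 0%R) (A 2%R)) + f_energy alpha (dist (A 1%R) (A 3%R))))%E.
Proof.
move=> uA; have [s0 s1 s2 s3] := ordS4.
rewrite /energy sum_ord4_pairs.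
have := uA 0; have := uA 1; have := uA 2; have := uA 3.
rewrite s0 s1 s2 s3 (distC (A 3)) => -> -> -> ->.
move: (f_energy alpha (dist (A 0) _)) (f_energy alpha (dist (A 1) _)).
move: (f_energy alpha 1) => a x y.
by rewrite (addeAC a x) (addeAC (a + a)%E x) -(addeA _ x y) (addeAC _ (x + y)%E).
Qed.

(** * The Euclidean inner product on the plane *)

Section Plane.
Context {R : realType}.
Implicit Types (P Q u v w : 'rV[R]_2).

Definition dot u v : R := u 0 0 * v 0 0 + u 0 1 * v 0 1.

Lemma rV2P u v : u 0 0 = v 0 0 -> u 0 1 = v 0 1 -> u = v.
Proof.
move=> e0 e1; apply/rowP => k.
have [->|->] : k = 0 \/ k = 1 by case: k => [[|[|//]]] ?; [left|right]; exact: val_inj.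
- exact: e0.
- exact: e1.
Qed.

Lemma sum_ord2 (F : 'I_2 -> R) : \sum_(k < 2) F k = F 0 + F 1.
Proof.
rewrite !big_ord_recl big_ord0 addr0; congr (F _ + F _); exact: val_inj.
Qed.

Lemma dotC u v : dot u v = dot v u.
Proof. by rewrite /dot mulrC (mulrC (u 0 1)). Qed.

Lemma dotDl u v w : dot (u + v) w = dot u w + dot v w.
Proof. by rewrite /dot !mxE; ring. Qed.

Lemma dotDr u v w : dot u (v + w) = dot u v + dot u w.
Proof. by rewrite dotC dotDl !(dotC u). Qed.

Lemma dotNl u v : dot (- u) v = - dot u v.
Proof. by rewrite /dot !mxE; ring. Qed.

Lemma dotNr u v : dot u (- v) = - dot u v.
Proof. by rewrite dotC dotNl dotC. Qed.

Lemma dotZl a u v : dot (a *: u) v = a * dot u v.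
Proof. by rewrite /dot !mxE; ring. Qed.

Lemma dotZr a u v : dot u (a *: v) = a * dot u v.
Proof. by rewrite dotC dotZl dotC. Qed.

Definition dotE := (dotDl, dotDr, dotNl, dotNr, dotZl, dotZr).

Lemma dot_ge0 u : 0 <= dot u u.
Proof. by rewrite /dot -!expr2 addr_ge0 ?sqr_ge0. Qed.

Lemma dot_eq0 u : dot u u = 0 -> u = 0.
Proof.
move=> /eqP; rewrite /dot -!expr2 paddr_eq0 ?sqr_ge0// !sqrf_eq0.
by case/andP=> /eqP u0 /eqP u1; apply: rV2P; rewrite !mxE.
Qed.

(** The equality case of Cauchy-Schwarz; it is how collinearity enters the computations. *)
Lemma dot_parallel u v w a b :
  u = a *: w -> v = b *: w -> dot u v ^+ 2 = dot u u * dot v v.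
Proof. by move=> -> ->; rewrite !dotE; ring. Qed.

(** By Lagrange's identity D^2 + (u.v)^2 = |u|^2 |v|^2 the determinant D of u and v is nonzero, and
    Cramer's rule recovers w from its products with u and v. *)
Lemma orthogonal_basis_dot0 u v w :
  dot u v = 0 -> u != 0 -> v != 0 -> dot w u = 0 -> dot w v = 0 -> w = 0.
Proof.
move=> uv u0 v0 wu wv.
set D := u 0 0 * v 0 1 - u 0 1 * v 0 0.
have D0 : D != 0.
  have D2 : D ^+ 2 = dot u u * dot v v.
    have -> : dot u u * dot v v = D ^+ 2 + dot u v ^+ 2 by rewrite /D /dot; ring.
    by rewrite uv expr0n addr0.
  rewrite -sqrf_eq0 D2 mulf_eq0 negb_or.
  by apply/andP; split; [apply: contra_neq u0|apply: contra_neq v0]; exact: dot_eq0.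
apply: rV2P; rewrite mxE; apply: (mulIf D0); rewrite mul0r.
- have -> : w 0 0 * D = dot w u * v 0 1 - dot w v * u 0 1 by rewrite /D /dot; ring.
  by rewrite wu wv !mul0r subrr.
- have -> : w 0 1 * D = dot w v * u 0 0 - dot w u * v 0 0 by rewrite /D /dot; ring.
  by rewrite wu wv !mul0r subrr.
Qed.

Lemma distE P Q : dist P Q = Num.sqrt (dot (P - Q) (P - Q)).
Proof. by rewrite /dist sum_ord2 /dot !mxE !expr2. Qed.

Lemma distxx P : dist P P = 0.
Proof. by rewrite distE subrr /dot !mxE mul0r addr0 sqrtr0. Qed.

Lemma sqr_dist P Q : dist P Q ^+ 2 = dot (P - Q) (P - Q).
Proof. by rewrite distE sqr_sqrtr ?dot_ge0. Qed.

Lemma dist_ge0 P Q : 0 <= dist P Q.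
Proof. exact: sqrtr_ge0. Qed.

Lemma dist_eq P Q d : 0 <= d -> dot (P - Q) (P - Q) = d ^+ 2 -> dist P Q = d.
Proof. by move=> d0 e; rewrite distE e sqrtr_sqr ger0_norm. Qed.

End Plane.

(** * Closed quadrilaterals with unit edges *)

Section Quadrilateral.
Context {R : realType} (A : 'I_4 -> 'rV[R]_2).

Lemma unit_edges4P :
  unit_edges A <->
  [/\ dot (A 1 - A 0) (A 1 - A 0) = 1, dot (A 2 - A 1) (A 2 - A 1) = 1,
      dot (A 3 - A 2) (A 3 - A 2) = 1 & dot (A 0 - A 3) (A 0 - A 3) = 1].
Proof.
have [s0 s1 s2 s3] := ordS4; split=> [uA|[e0 e1 e2 e3] i].
  have e i : dot (A (ordS i) - A i) (A (ordS i) - A i) = 1.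
    by rewrite -sqr_dist distC uA expr1n.
  by have := (e 0, e 1, e 2, e 3); rewrite s0 s1 s2 s3 => -[[[]]].
rewrite distC; apply: dist_eq => //; rewrite expr1n.
by case: (ord4P i) => ->; rewrite ?s0 ?s1 ?s2 ?s3.
Qed.

Hypothesis uA : unit_edges A.

(** The last equation encodes the closing edge: 1 = |p + q + r|^2 = 3 + 2 (p.q + q.r + p.r). *)
Lemma unit_edges_steps : exists p q r,
  [/\ A 1 = A 0 + p, A 2 = A 0 + p + q & A 3 = A 0 + p + q + r] /\
  [/\ dot p p = 1, dot q q = 1, dot r r = 1 &
      dot p q + dot q r + dot p r = - 1].
Proof.
have [p1 q1 r1 s1] := unit_edges4P.1 uA.
have H : A 0 - A 3 = - (A 1 - A 0 + (A 2 - A 1) + (A 3 - A 2)).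
  by apply: rV2P; rewrite !mxE; ring.
have A1 : A 1 = A 0 + (A 1 - A 0) by apply: rV2P; rewrite !mxE; ring.
have A2 : A 2 = A 0 + (A 1 - A 0) + (A 2 - A 1) by apply: rV2P; rewrite !mxE; ring.
have A3 : A 3 = A 0 + (A 1 - A 0) + (A 2 - A 1) + (A 3 - A 2).
  by apply: rV2P; rewrite !mxE; ring.
exists (A 1 - A 0), (A 2 - A 1), (A 3 - A 2); split=> //; split=> //.
rewrite H in s1.
move: (A 1 - A 0) (A 2 - A 1) (A 3 - A 2) p1 q1 r1 s1 => p q r p1 q1 r1.
by rewrite dotNl dotNr opprK !dotE !(dotC q p) !(dotC r _); lra.
Qed.

Lemma unit_edges_rhombus :
  [\/ A 0 = A 2, A 1 = A 3 | A 0 + A 2 = A 1 + A 3].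
Proof.
have [p [q [r [[-> -> ->] [p1 q1 r1 s1]]]]] := unit_edges_steps.
have [pq|pq] := eqVneq (p + q) 0; first by apply: Or31; rewrite -addrA pq addr0.
have [qr|qr] := eqVneq (q + r) 0.
  by apply: Or32; rewrite -[RHS]addrA qr addr0.
apply: Or33; suff pr : p + r = 0.
  have -> : p = - r by apply/eqP; rewrite -addr_eq0 pr.
  by apply: rV2P; rewrite !mxE; ring.
(* The products (p+q).(q+r), (p+r).(p+q) and (p+r).(q+r) all expand to 1 + p.q + q.r + p.r = 0. *)
apply: (@orthogonal_basis_dot0 _ (p + q) (q + r));
  rewrite ?pq ?qr ?dotE ?(dotC q p) ?(dotC r _) //; lra.
Qed.

(** The parallelogram law: here r = -p, and up to sign the diagonals are p + q and p - q. *)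
Lemma rhombus_diagonals : A 0 + A 2 = A 1 + A 3 ->
  dist (A 0) (A 2) ^+ 2 + dist (A 1) (A 3) ^+ 2 = 4.
Proof.
have [p [q [r [[-> -> ->] [p1 q1 r1 s1]]]]] := unit_edges_steps.
move=> pr; have {pr}-> : r = - p.
  by apply: rV2P; move/matrixP: pr => pr; [have := pr 0 0|have := pr 0 1];
   rewrite !mxE; lra.
have d02 : A 0 - (A 0 + p + q) = - (p + q) by apply: rV2P; rewrite !mxE; ring.
have d13 : A 0 + p - (A 0 + p + q - p) = p - q by apply: rV2P; rewrite !mxE; ring.
by rewrite !sqr_dist d02 d13 !dotE (dotC q p); lra.
Qed.

(** The unit vectors p and r are parallel, so p.r is 1 or -1. In the first case r = p and q = -p,
    and the polygon runs twice to and fro along one edge; in the second r = -p and the parallelogram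
    law applies. *)
Lemma collinear_unit_edges : collinear A ->
  (A 0 = A 2 /\ A 1 = A 3) \/
  dist (A 0) (A 2) ^+ 2 + dist (A 1) (A 3) ^+ 2 = 4.
Proof.
move=> [P [V AE]].
have [a0 A0] := AE 0; have [a1 A1] := AE 1; have [a2 A2] := AE 2; have [a3 A3] := AE 3.
have [p [q [r [[A1p A2q A3r] [p1 q1 r1 s1]]]]] := unit_edges_steps.
have pE : p = (a1 - a0) *: V.
  by rewrite scalerBl -(addKr (A 0) p) -A1p A0 A1 addrC opprD addrACA subrr add0r.
have rE : r = (a3 - a2) *: V.
  rewrite scalerBl -(addKr (A 2) r) A2q -A3r -A2q.
  by rewrite A2 A3 addrC opprD addrACA subrr add0r.
have := dot_parallel pE rE; rewrite p1 r1 mulr1 => /eqP.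
rewrite sqrf_eq1 => /orP[] /eqP pr.
  have rp : r = p.
    apply/eqP; rewrite -subr_eq0; apply/eqP/dot_eq0.
    by rewrite !dotE (dotC r p) p1 r1 pr; ring.
  have qp : q + p = 0.
    by apply/dot_eq0; move: s1; rewrite rp !dotE (dotC q p) p1 q1; lra.
  left; rewrite A1p A2q A3r rp -!addrA qp (addrC p q) qp !addr0; split => //.
right; apply: rhombus_diagonals.
have pr0 : p + r = 0 by apply: dot_eq0; rewrite !dotE (dotC r p) p1 r1 pr; ring.
have -> : A 3 = A 0 + q + (p + r) by rewrite A3r; apply: rV2P; rewrite !mxE; ring.
by rewrite A1p A2q pr0; apply: rV2P; rewrite !mxE; ring.
Qed.

End Quadrilateral.

(** * Convex hulls of vertex families *)

Section Hull.
Context {R : realType}.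
Implicit Types (M : set 'rV[R]_2) (P Q : 'rV[R]_2).

Lemma convex_setP M :
  @convex_set R 'rV[R]_2 M <->
  forall P Q (t : R), 0 <= t <= 1 -> M P -> M Q -> M (t *: P + (1 - t) *: Q).
Proof.
split=> [cM P Q t /andP[t0 t1] MP MQ|cM P Q t].
  by have := cM P Q (Itv01 t0 t1); rewrite !inE; exact.
by rewrite !inE; apply: cM; rewrite ge0 le1.
Qed.

Lemma hull_vertex n (A : 'I_n -> 'rV[R]_2) i : hull A (A i).
Proof. by apply: sub_gen_smallest; exists i. Qed.

Lemma hull_min n (A : 'I_n -> 'rV[R]_2) M :
  (forall P Q (t : R), 0 <= t <= 1 -> M P -> M Q -> M (t *: P + (1 - t) *: Q)) ->
  (forall i, M (A i)) -> hull A `<=` M.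
Proof.
move=> /convex_setP cM AM Q; apply; split => // _ [i _ <-]; exact: AM.
Qed.

Lemma hull_convex n (A : 'I_n -> 'rV[R]_2) P Q (t : R) :
  0 <= t <= 1 -> hull A P -> hull A Q -> hull A (t *: P + (1 - t) *: Q).
Proof.
move=> t01 hP hQ M MA; have [/convex_setP cM _] := MA.
by apply: cM => //; [exact: hP|exact: hQ].
Qed.

End Hull.

(** * Curves of period 1 and injective functions on an interval *)

Section Periodic.
Context {R : realType} {T : zmodType} (g : R -> T).
Hypothesis g1 : periodic g 1.

Lemma periodic1_int (n : int) x : g (x + n%:~R) = g x.
Proof.
case: n => n; first by rewrite -pmulrn (periodicn g1).
by rewrite NegzE mulrNz -pmulrn -[in RHS](subrK n.+1%:R x) (periodicn g1).
Qed.

Lemma int_translate (a x : R) : exists n : int, a <= x + n%:~R < a + 1.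
Proof.
exists (- Num.floor (x - a)); rewrite mulrNz.
have /andP[] := floor_itv (x - a); rewrite intrD; lra.
Qed.

Lemma int_translate_eq (s t : R) (m n : int) :
  `|s - t| < 1 -> s + m%:~R = t + n%:~R -> s = t.
Proof.
move=> st1 e; have st : s - t = (n - m)%:~R by rewrite intrB; lra.
apply/eqP; rewrite -subr_eq0; apply: contraTT st1 => st0.
by rewrite -leNgt norm_intr_ge1// st intr_int.
Qed.

(** Integer shifts move both parameters into [[0, 1[], where injectivity identifies them; so s - t
    is an integer of absolute value below 1. *)
Lemma periodic1_injective (s t : R) :
  {in `[0, 1[ &, injective g} -> `|s - t| < 1 -> g s = g t -> s = t.
Proof.
move=> gI st gst.
have [m sm] := int_translate 0 s; have [n tn] := int_translate 0 t.
rewrite !add0r in sm tn.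
apply: (int_translate_eq st (m := m) (n := n)).
by apply: gI; rewrite ?in_itv// !periodic1_int.
Qed.

End Periodic.

Lemma continuous_dot {R : realType} (T : topologicalType) (g : T -> 'rV[R]_2) P v :
  continuous g -> continuous (fun t => dot (g t - P) v).
Proof.
move=> gc t; rewrite /dot.
have gk k : {for t, continuous (fun t => (g t - P) 0 k)}.
  have -> : (fun t => (g t - P) 0 k) = (fun t => g t 0 k - P 0 k).
    by apply/funext => s; rewrite !mxE.
  apply: cvgB; last exact: cvg_cst.
  by apply: (@continuous_comp _ _ _ g (fun M : 'rV[R]_2 => M 0 k)); [exact: gc|exact: coord_continuous].
by apply: cvgD; (apply: cvgM; [exact: gk|exact: cvg_cst]).
Qed.

(** A continuous injective function on an interval is strictly monotone. *)
Lemma injective_min_endpoint {R : realType} (h : R -> R) a b s :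
  continuous h -> {in `[a, b] &, injective h} -> s \in `[a, b] ->
  (forall t, t \in `[a, b] -> h s <= h t) -> s = a \/ s = b.
Proof.
move=> hc hI sab hs; have /andP[as_ sb] : a <= s <= b by rewrite in_itv in sab.
have ab := le_trans as_ sb.
have aab : a \in `[a, b] by rewrite in_itv/= lexx.
have bab : b \in `[a, b] by rewrite in_itv/= lexx andbT.
have [hm|hm] := itv_continuous_inj_mono (continuous_subspaceT hc) hI.
- move: as_; rewrite le_eqVlt => /predU1P[->|sa]; first by left.
  by have := hm _ _ aab sab sa; rewrite ltNge hs.
- move: sb; rewrite le_eqVlt => /predU1P[->|sb]; first by right.
  by have := hm _ _ bab sab sb; rewrite ltNge hs.
Qed.

(** * Polygons excluded by the cyclic order on the boundary *)

Section Exclusion.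
Context {R : realType} (A : 'I_4 -> 'rV[R]_2) (g : R -> 'rV[R]_2).
Hypothesis uA : unit_edges A.
Hypothesis oA : occur_in_cyclic_order A g.

Let A01 : A 0 <> A 1.
Proof.
move=> e; have := uA 0; have [-> _ _ _] := ordS4.
by rewrite e distxx => /eqP; rewrite eq_sym oner_eq0.
Qed.

Let A12 : A 1 <> A 2.
Proof.
move=> e; have := uA 1; have [_ -> _ _] := ordS4.
by rewrite e distxx => /eqP; rewrite eq_sym oner_eq0.
Qed.

(** Equal opposite vertices would have equal parameters, and monotonicity of t would squeeze the
    vertex between them onto the same point, giving an edge of length 0. *)
Lemma simple_traversal_diagonals (B : set 'rV[R]_2) :
  simple_traversal B g -> A 0 <> A 2 /\ A 1 <> A 3.
Proof.
case=> _ g1 gI _; have [t [At tm tw]] := oA.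
have tE (i j : 'I_4) : (i <= j)%N -> A i = A j -> t i = t j.
  move=> ij; rewrite !At; apply: periodic1_injective => //.
  by rewrite ltr_norml; have := tm _ _ ij; have := tw i j; have := tw j i; lra.
split=> e; have := tE _ _ _ e => /(_ isT) te.
- apply: A01; rewrite !At; congr g.
  have := tm 0 1 isT; have := tm 1 2 isT; lra.
- apply: A12; rewrite !At; congr g.
  have := tm 1 2 isT; have := tm 2 3 isT; lra.
Qed.

(** For the alternating polygon the hull is the segment from A 0 to A 1, and the curve meets its end
    A 0 only once per period. Hence t 0 = t 2, which forces t 1 to the same value although A 0 and A
    1 differ. *)
Lemma forth_and_back_alternating :
  forth_and_back_traversal (hull A) g -> ~ (A 0 = A 2 /\ A 1 = A 3).
Proof.
case=> gc g1 [a [b [/andP[ab ba1] gIab gab gIba gba]]] [A02 A13].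
have [t [At tm tw]] := oA.
set V := A 1 - A 0.
have VV : dot V V = 1 by have [] := (unit_edges4P A).1 uA.
have dot0V : dot (A 0 - A 0) V = 0 by rewrite subrr /dot !mxE !mul0r addr0.
(* [h] is the position along the segment, measured from A 0; on the hull it is nonnegative and
   determines the point. *)
pose h s := dot (g s - A 0) V.
have hc : continuous h by exact: continuous_dot.
have hullE Q : hull A Q -> Q = A 0 + dot (Q - A 0) V *: V /\ 0 <= dot (Q - A 0) V.
  apply: (hull_min (M := [set Q | Q = A 0 + dot (Q - A 0) V *: V /\
                                   0 <= dot (Q - A 0) V])) => /=.
    move=> P P' x /andP[x0 x1] [PE P0] [PE' P0'].
    have -> : dot (x *: P + (1 - x) *: P' - A 0) V =
        x * dot (P - A 0) V + (1 - x) * dot (P' - A 0) V.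
      by rewrite !dotE; ring.
    split; last by rewrite addr_ge0 ?mulr_ge0 ?subr_ge0.
    by rewrite {1}PE {1}PE'; apply: rV2P; rewrite !mxE; ring.
  move=> i; have : A i = A 0 \/ A i = A 1.
    by case: (ord4P i) => ->; [left|right|left|right].
  case=> ->; first by rewrite dot0V scale0r addr0.
  by rewrite -/V VV scale1r; split=> //; rewrite /V addrC subrK.
have h_inj s s' : hull A (g s) -> hull A (g s') -> h s = h s' -> g s = g s'.
  by move=> /hullE[-> _] /hullE[-> _]; rewrite -/(h s) -/(h s') => ->.
(* Since [h] is minimal at A 0, an injective passage over the segment can meet A 0 only at its first
   or last parameter. *)
have end_pt x y s : {in `[x, y] &, injective g} -> g @` `[x, y] = hull A ->
    s \in `[x, y] -> g s = A 0 -> s = x \/ s = y.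
  move=> gI gxy sxy gs.
  have hg s' : s' \in `[x, y] -> hull A (g s') by move=> ?; rewrite -gxy; exists s'.
  apply: (injective_min_endpoint hc) => //.
    by move=> u w uI wI /h_inj-/(_ (hg _ uI) (hg _ wI))/gI->.
  move=> u uI; rewrite {1}/h gs subrr.
  have [_] := hullE _ (hg _ uI); apply: le_trans.
  by rewrite /dot !mxE !mul0r addr0.
have loc s : a <= s < a + 1 -> g s = A 0 -> s = a \/ s = b.
  move=> /andP[as_ sa1] gs; have [sb|bs] := leP s b.
    by apply: end_pt gIab gab _ gs; rewrite in_itv/= as_.
  have [|sb|sa] := end_pt _ _ s gIba gba _ gs; last 2 first.
  - by right.
  - by move: sa1; rewrite sa ltxx.
  - by rewrite in_itv/= (ltW bs) (ltW sa1).
(* The parameters a and b cannot both be mapped to A 0, by injectivity on [[a, b]]; this leaves one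
   visit in [[a, a + 1[]. *)
have gab_neq : g a = A 0 -> g b = A 0 -> False.
  move=> ga gb; have := gIab a b; rewrite !in_itv/= !lexx (ltW ab) ga gb.
  by move=> /(_ isT isT erefl) e; rewrite e ltxx in ab.
have [m mt] := int_translate a (t 0); have [n nt] := int_translate a (t 2).
have gm : g (t 0 + m%:~R) = A 0 by rewrite periodic1_int// -At.
have gn : g (t 2 + n%:~R) = A 0 by rewrite periodic1_int// -At.
have e : t 0 + m%:~R = t 2 + n%:~R.
  have [ta|ta] := loc _ mt gm; have [tb|tb] := loc _ nt gn; rewrite ?ta ?tb//;
    by rewrite ta in gm; rewrite tb in gn; case: gab_neq.
apply: A01; rewrite !At; congr g.
have t02 : t 0 = t 2.
  apply: int_translate_eq e; rewrite ltr_norml.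
  by have := tm 0 2 isT; have := tw 0 2; have := tw 2 0; lra.
have := tm 0 1 isT; have := tm 1 2 isT; lra.
Qed.

End Exclusion.

Lemma convex_unit_polygon_diagonals {R : realType} (A : 'I_4 -> 'rV[R]_2) :
  convex_unit_polygon A -> dist (A 0) (A 2) ^+ 2 + dist (A 1) (A 3) ^+ 2 = 4.
Proof.
move=> [uA [g [[gnc gcol] oA]]].
have [colA|ncolA] := pselect (collinear A).
  have [alt|//] := collinear_unit_edges uA colA.
  by have := forth_and_back_alternating uA oA (gcol colA) alt.
have [A02 A13] := simple_traversal_diagonals uA oA (gnc ncolA).
by have [//|//|] := unit_edges_rhombus uA; exact: rhombus_diagonals.
Qed.

(** * The unit circle and the signed square *)

Section Trigo.
Context {R : realType}.
Implicit Types x y : R.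

Lemma cos_eq1 x : 0 <= x < pi *+ 2 -> cos x = 1 -> x = 0.
Proof.
move=> /andP[x0 x2] cx.
have [xpi|pix] := leP x pi.
  by apply: cos_inj; rewrite ?in_itv/= ?x0 ?xpi ?lexx ?pi_ge0// cos0.
(* Beyond pi the reflected angle 2 pi - x lies in [0, pi], where cos is injective; it would force x
   = 2 pi, outside the range. *)
have : pi *+ 2 - x = 0.
  apply: cos_inj; rewrite ?in_itv/= ?lexx ?pi_ge0 ?cos0//; first by rewrite mulr2n in x2 *; lra.
  by rewrite addrC (cosD2pi) cosN.
by move/eqP; rewrite subr_eq0 => /eqP e; rewrite e ltxx in x2.
Qed.

(** The addition formula gives cos (x - y) = cos^2 + sin^2 = 1. *)
Lemma cos_sin_inj x y : `|x - y| < pi *+ 2 ->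
  cos x = cos y -> sin x = sin y -> x = y.
Proof.
wlog yx : x y / y <= x => [hw|].
  have [yx|/ltW xy] := leP y x; first exact: hw.
  by rewrite distrC => d c s; apply/esym/hw.
rewrite ger0_norm ?subr_ge0// => d c s.
apply/eqP; rewrite -subr_eq0; apply/eqP/cos_eq1; first by rewrite subr_ge0 yx.
by rewrite cosB c s -!expr2 cos2Dsin2.
Qed.

Lemma cos_sin_surj x y : x ^+ 2 + y ^+ 2 = 1 -> exists t : R, cos t = x /\ sin t = y.
Proof.
move=> xy; have x1 : -1 <= x <= 1 by have := sqr_ge0 y; nra.
have sx : Num.sqrt (1 - x ^+ 2) = `|y| by rewrite -xy addrAC subrr add0r sqrtr_sqr.
have cx : cos (acos x) = x by rewrite acosK.
have [y0|y0] := leP 0 y.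
  by exists (acos x); rewrite sin_acos// sx ger0_norm.
by exists (- acos x); rewrite cosN sinN sin_acos// sx ltr0_norm// opprK.
Qed.

(** Applied to both coordinates, this signed square carries the circle x^2 + y^2 = 1 to the l1
    circle |x| + |y| = 1; injectivity will make the rhombus boundary a simple curve. *)
Lemma mul_norm_inj : injective (fun x : R => x * `|x|).
Proof.
move=> x y /=; have [x0|x0] := leP 0 x; have [y0|y0] := leP 0 y.
- by rewrite !ger0_norm// -!expr2 => /eqP; rewrite eqrXn2// => /eqP.
- by rewrite ger0_norm// ltr0_norm//; nra.
- by rewrite ltr0_norm// ger0_norm//; nra.
- rewrite !ltr0_norm// !mulrN => /oppr_inj; rewrite -!expr2 -sqrrN -[in RHS]sqrrN.
  by move/eqP; rewrite eqrXn2 ?oppr_ge0 ?ltW// => /eqP/oppr_inj.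
Qed.

(** The second conjunct places the preimage of a point of the l1 circle on the unit circle. *)
Lemma mul_norm_surj x : exists y, y * `|y| = x /\ y ^+ 2 = `|x|.
Proof.
exists (Num.sg x * Num.sqrt `|x|).
have s2 : Num.sqrt `|x| ^+ 2 = `|x| by rewrite sqr_sqrtr.
have [x0|x0|->] := ltgtP x 0.
- rewrite ltr0_sg// mulN1r normrN (ger0_norm (sqrtr_ge0 _)) sqrrN mulNr -expr2 s2.
  by rewrite ltr0_norm// opprK.
- rewrite gtr0_sg// mul1r (ger0_norm (sqrtr_ge0 _)) -expr2 s2.
  by rewrite gtr0_norm.
- by rewrite sgr0 !mul0r normr0 expr0n.
Qed.

End Trigo.

(** * Hull and boundary of a nondegenerate rhombus *)

Section Rhombus.
Context {R : realType} (c u v : 'rV[R]_2).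
Hypotheses (uv : dot u v = 0) (u0 : u != 0) (v0 : v != 0).
Implicit Types (P Q : 'rV[R]_2).

Let uu0 : dot u u != 0.
Proof. by apply: contra_neq u0; exact: dot_eq0. Qed.

Let vv0 : dot v v != 0.
Proof. by apply: contra_neq v0; exact: dot_eq0. Qed.

(** Because u and v are orthogonal, the coordinates in the frame with origin c and axes u, v are
    projections. *)
Definition xcoord Q := dot (Q - c) u / dot u u.
Definition ycoord Q := dot (Q - c) v / dot v v.
Definition l1norm Q := `|xcoord Q| + `|ycoord Q|.
Definition point x y : 'rV[R]_2 := c + (x *: u + y *: v).

Lemma xcoord_point x y : xcoord (point x y) = x.
Proof. by rewrite /xcoord /point addrC addKr !dotE (dotC v) uv mulr0 addr0 mulfK. Qed.

Lemma ycoord_point x y : ycoord (point x y) = y.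
Proof. by rewrite /ycoord /point addrC addKr !dotE uv mulr0 add0r mulfK. Qed.

Lemma point_coord Q : point (xcoord Q) (ycoord Q) = Q.
Proof.
apply/eqP; rewrite -subr_eq0; apply/eqP.
apply: (orthogonal_basis_dot0 uv u0 v0).
- have -> : point (xcoord Q) (ycoord Q) - Q =
    xcoord Q *: u + ycoord Q *: v - (Q - c) by apply: rV2P; rewrite !mxE; ring.
  by rewrite dotDl dotNl !dotE (dotC v) uv mulr0 addr0 divfK// !dotE subrr.
- have -> : point (xcoord Q) (ycoord Q) - Q =
    xcoord Q *: u + ycoord Q *: v - (Q - c) by apply: rV2P; rewrite !mxE; ring.
  by rewrite dotDl dotNl !dotE uv mulr0 add0r divfK// !dotE subrr.
Qed.

Lemma continuous_l1norm (T : topologicalType) (g : T -> 'rV[R]_2) :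
  continuous g -> continuous (fun t => l1norm (g t)).
Proof.
move=> gc; have cd w k : continuous (fun t => `|dot (g t - c) w / k|).
  move=> t; apply: cvg_norm; apply: cvgM; last exact: cvg_cst.
  exact: continuous_dot.
by move=> t; apply: cvgD; exact: cd.
Qed.

Lemma continuous_point (T : topologicalType) (f g : T -> R) :
  continuous f -> continuous g -> continuous (fun t => point (f t) (g t)).
Proof.
move=> fc gc t; apply: cvgD; first exact: cvg_cst.
by apply: cvgD; apply: cvgZr_tmp; [exact: fc|exact: gc].
Qed.

Lemma l1norm_point x y : l1norm (point x y) = `|x| + `|y|.
Proof. by rewrite /l1norm xcoord_point ycoord_point. Qed.

Context (A : 'I_4 -> 'rV[R]_2).
Hypotheses (A0 : A 0 = c + u) (A1 : A 1 = c + v) (A2 : A 2 = c - u) (A3 : A 3 = c - v).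

(** The l1 ball is convex by the triangle inequality and contains the vertices. Conversely each of
    its points is a convex combination of a point on one diagonal and a point on the other. *)
Lemma hull_rhombus : hull A = [set Q | l1norm Q <= 1].
Proof.
apply/seteqP; split.
  apply: hull_min.
    move=> P Q t /andP[t0 t1] /=; rewrite -{1 2}(point_coord P) -{1 2}(point_coord Q).
    have -> : forall a b a' b', t *: point a b + (1 - t) *: point a' b' =
        point (t * a + (1 - t) * a') (t * b + (1 - t) * b').
      by move=> a b a' b'; apply: rV2P; rewrite !mxE; ring.
    rewrite !l1norm_point.
    move: (xcoord P) (ycoord P) (xcoord Q) (ycoord Q) => a b a' b' h h'.
    have tri (s s' : R) : `|t * s + (1 - t) * s'| <= t * `|s| + (1 - t) * `|s'|.
      by rewrite (le_trans (ler_normD _ _))// !normrM (ger0_norm t0) (@ger0_norm _ (1 - t)) ?subr_ge0.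
    have := tri a a'; have := tri b b'; nra.
  move=> i /=.
  have [->|->|->|->] := ord4P i.
  - have -> : A 0 = point 1 0 by rewrite A0 /point scale1r scale0r addr0.
    by rewrite l1norm_point normr1 normr0 addr0.
  - have -> : A 1 = point 0 1 by rewrite A1 /point scale1r scale0r add0r.
    by rewrite l1norm_point normr1 normr0 add0r.
  - have -> : A 2 = point (-1) 0 by rewrite A2 /point scaleN1r scale0r addr0.
    by rewrite l1norm_point normrN1 normr0 addr0.
  - have -> : A 3 = point 0 (-1) by rewrite A3 /point scaleN1r scale0r add0r.
    by rewrite l1norm_point normrN1 normr0 add0r.
move=> Q /=; rewrite -{1 2}(point_coord Q) l1norm_point.
move: (xcoord Q) (ycoord Q) => x y xy.
have axis w (s : R) : hull A (c + w) -> hull A (c - w) -> `|s| <= 1 -> hull A (c + s *: w).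
  move=> hw hNw; rewrite ler_norml => /andP[s1 s2].
  have -> : c + s *: w = ((1 + s) / 2) *: (c + w) + (1 - (1 + s) / 2) *: (c - w).
    by apply: rV2P; rewrite !mxE; field.
  by apply: hull_convex => //; lra.
have hu s : `|s| <= 1 -> hull A (c + s *: u).
  by apply: axis; rewrite -?A0 -?A2; exact: hull_vertex.
have hv s : `|s| <= 1 -> hull A (c + s *: v).
  by apply: axis; rewrite -?A1 -?A3; exact: hull_vertex.
(* The weight is the midpoint of |x| and 1 - |y|, so that |x| <= l and |y| <= 1 - l. *)
pose l := (1 + `|x| - `|y|) / 2.
have xl : `|x| <= l by rewrite /l; lra.
have yl : `|y| <= 1 - l by rewrite /l; lra.
(* If b = 0 then a = 0, and the convention a / 0 = 0 keeps both claims true, so l may be 0 or 1. *)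
have scale (a b : R) : `|a| <= b -> b * (a / b) = a /\ `|a / b| <= 1.
  move=> ab; have := normr_ge0 a; have [b0|b0] := eqVneq b 0.
    move: ab; rewrite b0 => ab _; have /eqP : `|a| = 0 by apply/eqP; rewrite eq_le ab/=.
    by rewrite normr_eq0 => /eqP ->; rewrite !mul0r normr0.
  move=> a0; split; first by rewrite mulrC divfK.
  have bp : 0 < b by rewrite lt_def b0 (le_trans a0).
  by rewrite normrM normfV (ger0_norm (ltW bp)) ler_pdivrMr// mul1r.
have [lx xl1] := scale _ _ xl; have [ly yl1] := scale _ _ yl.
have -> : point x y = l *: (c + (x / l) *: u) + (1 - l) *: (c + (y / (1 - l)) *: v).
  rewrite /point -{1}lx -{1}ly; apply: rV2P; rewrite !mxE; ring.
apply: hull_convex; [|exact: hu|exact: hv].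
by have := normr_ge0 x; have := normr_ge0 y; lra.
Qed.

Lemma frontier_rhombus : frontier (hull A) = [set Q | l1norm Q = 1].
Proof.
rewrite hull_rhombus /frontier.
have cl : closed [set Q | l1norm Q <= 1].
  exact: (closed_comp (fun Q _ => @continuous_l1norm _ id (fun=> cvg_id) Q) (@closed_le R 1)).
have op : open [set Q | l1norm Q < 1].
  exact: (open_comp (fun Q _ => @continuous_l1norm _ id (fun=> cvg_id) Q) (@open_lt R 1)).
rewrite -(closure_id _).1//; apply/seteqP; split=> Q /=.
  move=> [NQ NI]; apply/eqP; rewrite eq_le NQ/= leNgt; apply/negP => Q1; apply: NI.
  have : [set P | l1norm P < 1] `<=` [set P | l1norm P <= 1]° by rewrite -open_subsetE// => P /ltW.
  exact.
move=> NQ; split; first by rewrite NQ.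
move=> IQ.
(* [f] dilates by t about c. An interior point would stay in the hull for t slightly above 1, but
   the dilated point has l1 norm t. *)
pose f (t : R) := point (t * xcoord Q) (t * ycoord Q).
have fc : {for 1, continuous f}.
  by apply: continuous_point => t; apply: cvgM; (exact: cvg_id || exact: cvg_cst).
have f1 : f 1 = Q by rewrite /f !mul1r point_coord.
have fI : nbhs (f 1) [set P | l1norm P <= 1] by rewrite f1; exact: IQ.
have /nbhs_ballP[e /= e0 be] : nbhs (1 : R) [set t | l1norm (f t) <= 1] := fc _ fI.
have /be : ball (1 : R) e (1 + e / 2).
  by rewrite /ball/= opprD addrA subrr sub0r normrN ger0_norm; lra.
rewrite /= /f l1norm_point !(normrM (1 + _)) -mulrDr (NQ : `|xcoord Q| + `|ycoord Q| = 1) mulr1 ger0_norm; lra.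
Qed.

Definition rhombus_traversal (t : R) : 'rV[R]_2 :=
  let a := t * (pi *+ 2) in point (cos a * `|cos a|) (sin a * `|sin a|).

Lemma simple_rhombus_traversal : simple_traversal (frontier (hull A)) rhombus_traversal.
Proof.
have angc : continuous (fun t : R => t * (pi *+ 2)).
  by move=> t; apply: cvgM; [exact: cvg_id|exact: cvg_cst].
have cc : continuous (fun t : R => cos (t * (pi *+ 2))).
  by move=> t; apply: (continuous_comp (angc t)); exact: continuous_cos.
have sc : continuous (fun t : R => sin (t * (pi *+ 2))).
  by move=> t; apply: (continuous_comp (angc t)); exact: continuous_sin.
split.
- by apply: continuous_point => t; (apply: cvgM; [|apply: cvg_norm]); (exact: cc || exact: sc).
- by move=> t; rewrite /rhombus_traversal mulrDl mul1r cosD2pi sinD2pi.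
- move=> s t; rewrite !in_itv/= => /andP[s0 s1] /andP[t0 t1] e.
  have := congr1 xcoord e; have := congr1 ycoord e.
  rewrite !xcoord_point !ycoord_point => /mul_norm_inj ss /mul_norm_inj cs.
  have pi2 : 0 < pi *+ 2 :> R by rewrite mulrn_wgt0// pi_gt0.
  apply: (mulIf (lt0r_neq0 pi2)); apply: cos_sin_inj => //.
  rewrite -mulrBl normrM (gtr0_norm pi2) gtr_pMl// ltr_norml; lra.
- rewrite frontier_rhombus; apply/seteqP; split.
    by move=> _ [t _ <-] /=; rewrite l1norm_point !normrM !normr_id -!expr2 !real_normK ?num_real// cos2Dsin2.
  move=> Q /= NQ.
  have [x [xE x2]] := mul_norm_surj (xcoord Q); have [y [yE y2]] := mul_norm_surj (ycoord Q).
  have [t [ct st]] := cos_sin_surj (etrans (congr2 +%R x2 y2) NQ).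
  exists (t / (pi *+ 2)) => //.
  rewrite /rhombus_traversal divfK ?ct ?st ?xE ?yE ?point_coord//.
  by rewrite gt_eqF// mulrn_wgt0// pi_gt0.
Qed.

(** Otherwise u and v would be parallel, and (u.v)^2 = |u|^2 |v|^2 contradicts their being
    orthogonal and nonzero. *)
Lemma rhombus_not_collinear : ~ collinear A.
Proof.
move=> [P [V AE]].
have [a0 E0] := AE 0; have [a1 E1] := AE 1; have [a2 E2] := AE 2; have [a3 E3] := AE 3.
have uE : u = ((a0 - a2) / 2) *: V.
  have -> : u = 2^-1 *: (A 0 - A 2) by rewrite A0 A2; apply: rV2P; rewrite !mxE; field.
  by rewrite E0 E2; apply: rV2P; rewrite !mxE; field.
have vE : v = ((a1 - a3) / 2) *: V.
  have -> : v = 2^-1 *: (A 1 - A 3) by rewrite A1 A3; apply: rV2P; rewrite !mxE; field.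
  by rewrite E1 E3; apply: rV2P; rewrite !mxE; field.
have /eqP := dot_parallel uE vE.
by rewrite uv expr0n eq_sym mulf_eq0 (negbTE uu0) (negbTE vv0).
Qed.

Lemma rhombus_cyclic_order : occur_in_cyclic_order A rhombus_traversal.
Proof.
have quarter : 4^-1 * (pi *+ 2) = pi / 2 :> R by rewrite -mulr_natr; field.
have half : 2^-1 * (pi *+ 2) = pi :> R by rewrite -mulr_natr; field.
have threeq : 3 / 4 * (pi *+ 2) = pi + pi / 2 :> R by rewrite -mulr_natr; field.
(* At parameter i/4 the angle is i pi/2, where the curve passes through c + u, c + v, c - u, c - v
   in turn. *)
exists (fun i => (i : nat)%:R / 4); split.
- move=> i; have [->|->|->|->] := ord4P i; rewrite /rhombus_traversal.
  + by rewrite !mul0r cos0 sin0 normr1 mulr1 mul0r /point scale1r scale0r addr0.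
  + rewrite mul1r quarter cos_pihalf sin_pihalf normr1 mulr1 mul0r.
    by rewrite /point scale1r scale0r add0r.
  + have -> : (2%:R / 4 : R) = 2^-1 by field.
    rewrite half cospi sinpi normrN1 mulr1 mul0r.
    by rewrite /point scaleN1r scale0r addr0.
  + rewrite threeq addrC cosDpi sinDpi cos_pihalf sin_pihalf oppr0 normrN1 mulr1 mul0r.
    by rewrite /point scaleN1r scale0r add0r.
- by move=> i j ij; rewrite ler_pM2r// ler_nat.
- move=> i j; have : (j : nat)%:R < 4 :> R by rewrite ltr_nat.
  by have : 0 <= (i : nat)%:R :> R by []; lra.
Qed.

Lemma convex_unit_rhombus : unit_edges A -> convex_unit_polygon A.
Proof.
move=> uA; split=> //; exists rhombus_traversal; split; last exact: rhombus_cyclic_order.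
by split=> [_|/rhombus_not_collinear//]; exact: simple_rhombus_traversal.
Qed.

End Rhombus.

(** * The unit square *)

Section Square.
Context {R : realType} (S : 'I_4 -> 'rV[R]_2).
Hypothesis sqS : unit_square S.

Let uS : unit_edges S.
Proof. by have [] := sqS. Qed.

Let square_angles :
  [/\ dot (S 1 - S 0) (S 2 - S 1) = 0, dot (S 2 - S 1) (S 3 - S 2) = 0 &
      dot (S 3 - S 2) (S 0 - S 3) = 0].
Proof.
have [s0 s1 s2 s3] := ordS4; have [_ h] := sqS.
have e i : dot (S (ordS i) - S i) (S (ordS (ordS i)) - S (ordS i)) = 0.
  by rewrite -[RHS](h i) sum_ord2 /dot !mxE.
by split; [have := e 0|have := e 1|have := e 2]; rewrite ?s0 ?s1 ?s2 ?s3.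
Qed.

Lemma square_diagonals :
  dist (S 0) (S 2) = Num.sqrt 2 /\ dist (S 1) (S 3) = Num.sqrt 2.
Proof.
have [e0 e1 _] := square_angles.
have [p1 q1 r1 _] := (unit_edges4P S).1 uS.
split; apply: dist_eq; rewrite ?sqrtr_ge0// sqr_sqrtr//.
- have -> : S 0 - S 2 = - (S 1 - S 0 + (S 2 - S 1)) by apply: rV2P; rewrite !mxE; ring.
  move: (S 1 - S 0) (S 2 - S 1) p1 q1 e0 => p q p1 q1 e0.
  by rewrite !dotE (dotC q p) p1 q1 e0; lra.
- have -> : S 1 - S 3 = - (S 2 - S 1 + (S 3 - S 2)) by apply: rV2P; rewrite !mxE; ring.
  move: (S 2 - S 1) (S 3 - S 2) q1 r1 e1 => q r q1 r1 e1.
  by rewrite !dotE (dotC r q) r1 q1 e1; lra.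
Qed.

(** The diagonals have length sqrt 2, so neither vanishes and the square is a rhombus; its diagonals
    are orthogonal as for any closed quadrilateral with unit edges. *)
Lemma square_convex : convex_unit_polygon S.
Proof.
have [d02 d13] := square_diagonals.
have s2 : Num.sqrt 2 != 0 :> R by rewrite gt_eqF// sqrtr_gt0.
have S02 : S 0 - S 2 != 0 by rewrite subr_eq0; apply: contra_neq s2 => e; rewrite -d02 e distxx.
have S13 : S 1 - S 3 != 0 by rewrite subr_eq0; apply: contra_neq s2 => e; rewrite -d13 e distxx.
have mid : S 0 + S 2 = S 1 + S 3.
  by have [e|e|//] := unit_edges_rhombus uS; [move: S02|move: S13]; rewrite e subrr eqxx.
have diag : dot (S 0 - S 2) (S 1 - S 3) = 0.
  have [p [q [r [[-> -> ->] [p1 q1 r1 s1]]]]] := unit_edges_steps uS.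
  have -> : S 0 - (S 0 + p + q) = - (p + q) by apply: rV2P; rewrite !mxE; ring.
  have -> : S 0 + p - (S 0 + p + q + r) = - (q + r) by apply: rV2P; rewrite !mxE; ring.
  by rewrite !dotE; lra.
have half0 w : w != 0 -> 2^-1 *: w != 0 :> 'rV[R]_2.
  by move=> w0; rewrite scaler_eq0 (negbTE w0) orbF invr_eq0.
apply: (@convex_unit_rhombus _ (2^-1 *: (S 0 + S 2)) (2^-1 *: (S 0 - S 2))
  (2^-1 *: (S 1 - S 3))) => //; rewrite ?dotZl ?dotZr ?diag ?mulr0 ?half0//.
- by apply: rV2P; rewrite !mxE; field.
- by rewrite mid; apply: rV2P; rewrite !mxE; field.
- by apply: rV2P; rewrite !mxE; field.
- by rewrite mid; apply: rV2P; rewrite !mxE; field.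
Qed.

End Square.

Lemma unit_square_exists (R : realType) : exists S : 'I_4 -> 'rV[R]_2, unit_square S.
Proof.
(* The vertices (0,0), (1,0), (1,1), (0,1). *)
exists (fun i => \row_(k < 2) (if k == 0 then (0 < i < 3)%N else (1 < i)%N)%:R); split.
  by apply/unit_edges4P; rewrite /dot !mxE /=; split; ring.
move=> i; rewrite sum_ord2; have [s0 s1 s2 s3] := ordS4.
by case: (ord4P i) => ->; rewrite ?s0 ?s1 ?s2 ?s3 !mxE /=; ring.
Qed.

(** * The double straight arc *)

Section DoubleSegment.
Context {R : realType} (e : 'rV[R]_2).
Hypothesis e1 : dot e e = 1.

(** The coefficient min (i, 4 - i) runs through 0, 1, 2, 1. *)
Definition double_segment (i : 'I_4) : 'rV[R]_2 := (minn i (4 - i))%:R *: e.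

(** The position 1 - cos rises from 0 to 2 in the first half period and returns in the second. *)
Definition double_segment_traversal (t : R) : 'rV[R]_2 :=
  (1 - cos (t * (pi *+ 2))) *: e.

Let scale_inj : injective (fun x : R => x *: e).
Proof. by move=> x y /(congr1 (dot^~ e)); rewrite !dotZl e1 !mulr1. Qed.

Lemma double_segmentE :
  [/\ double_segment 0 = 0, double_segment 1 = e, double_segment 2 = 2 *: e &
      double_segment 3 = e].
Proof.
rewrite /double_segment; split=> //; first by rewrite scale0r.
- by rewrite (_ : minn _ _ = 1%N)// scale1r.
- by rewrite (_ : minn _ _ = 1%N)// scale1r.
Qed.

Lemma hull_double_segment :
  hull double_segment = [set x *: e | x in `[0, 2]].
Proof.
apply/seteqP; split.
  apply: hull_min.
    move=> _ _ t /andP[t0 t1] [x /= + <-] [y /= + <-].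
    rewrite !in_itv/= => /andP[x0 x2] /andP[y0 y2].
    exists (t * x + (1 - t) * y); last by rewrite /= !scalerA -scalerDl.
    by rewrite /= in_itv/=; nra.
  move=> i; exists ((minn i (4 - i))%:R) => //.
  by rewrite /= in_itv/= ler0n ler_nat; case: (ord4P i) => ->.
move=> _ [x /= + <-]; rewrite in_itv/= => /andP[x0 x2].
have -> : x *: e = (1 - x / 2) *: double_segment 0 + (1 - (1 - x / 2)) *: double_segment 2.
  by have [-> _ -> _] := double_segmentE; rewrite scaler0 add0r scalerA; congr (_ *: e); field.
by apply: hull_convex; [|exact: hull_vertex|exact: hull_vertex]; lra.
Qed.

Lemma double_segment_unit_edges : unit_edges double_segment.
Proof.
apply/unit_edges4P; have [-> -> -> ->] := double_segmentE.
have -> : 2 *: e - e = e by rewrite scaler_nat mulr2n addrK.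
have -> : e - 2 *: e = - e by rewrite scaler_nat mulr2n opprD addNKr.
by rewrite subr0 sub0r dotNl dotNr opprK.
Qed.

Lemma double_segment_collinear : collinear double_segment.
Proof. by exists 0, e => i; exists (minn i (4 - i))%:R; rewrite add0r. Qed.

Lemma double_segment_forth_and_back :
  forth_and_back_traversal (hull double_segment) double_segment_traversal.
Proof.
have pi0 := @pi_gt0 R.
have pi2 : 0 < pi *+ 2 :> R by rewrite mulr2n addr_gt0.
have refl (t : R) : cos (t * (pi *+ 2)) = cos ((1 - t) * (pi *+ 2)).
  by rewrite mulrBl mul1r addrC cosD2pi cosN.
have cosI (s t : R) : 0 <= s <= 2^-1 -> 0 <= t <= 2^-1 ->
    double_segment_traversal s = double_segment_traversal t -> s = t.
  move=> s0 t0 /scale_inj st.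
  apply: (mulIf (lt0r_neq0 pi2)); apply: cos_inj; last by lra.
    by rewrite in_itv/= mulr2n; nra.
  by rewrite in_itv/= mulr2n; nra.
have cos_surj x : 0 <= x <= 2 -> exists2 t : R, 0 <= t <= 2^-1 &
    double_segment_traversal t = x *: e.
  move=> x02; have x1 : -1 <= 1 - x <= 1 by lra.
  exists (acos (1 - x) / (pi *+ 2)).
    have := acos_ge0 x1; have := acos_lepi x1 => h1 h2.
    by rewrite ler_pdivlMr// ler_pdivrMr// mulr2n; lra.
  rewrite /double_segment_traversal divfK ?gt_eqF//.
  by rewrite acosK ?in_itv//; congr (_ *: e); ring.
have range x : hull double_segment (double_segment_traversal x).
  rewrite hull_double_segment; exists (1 - cos (x * (pi *+ 2))) => //=.
  by rewrite in_itv/=; have := cos_le1 (x * (pi *+ 2)); have := cos_geN1 (x * (pi *+ 2)); lra.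
(* The reflection of t to 1 - t exchanges the two half periods, so the way back inherits injectivity
   and surjectivity from the way forth. *)
have sym t : double_segment_traversal t = double_segment_traversal (1 - t).
  by rewrite /double_segment_traversal refl.
split.
- move=> t; apply: cvgZr_tmp; apply: cvgB; first exact: cvg_cst.
  apply: (@continuous_comp _ _ _ (fun t : R => t * (pi *+ 2)) cos); last exact: continuous_cos.
  by apply: cvgM; [exact: cvg_id|exact: cvg_cst].
- by move=> t; rewrite /double_segment_traversal mulrDl mul1r cosD2pi.
exists 0, 2^-1; split; first by lra.
- by move=> s t; rewrite !in_itv/=; exact: cosI.
- apply/seteqP; split=> [_ [t _ <-]|Q]; first exact: range.
  rewrite hull_double_segment => -[x /=]; rewrite in_itv/= => x02 <-.
  by have [t t0 <-] := cos_surj _ x02; exists t => //=; rewrite in_itv.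
- move=> s t; rewrite !in_itv/= (sym s) (sym t) => s1 t1 st.
  suff : 1 - s = 1 - t by lra.
  by apply: cosI st; lra.
- apply/seteqP; split=> [_ [t _ <-]|Q]; first exact: range.
  rewrite hull_double_segment => -[x /=]; rewrite in_itv/= => x02 <-.
  have [t t0 <-] := cos_surj _ x02; exists (1 - t); last by rewrite -sym.
  by rewrite /= in_itv/=; lra.
Qed.

Lemma double_segment_cyclic_order :
  occur_in_cyclic_order double_segment double_segment_traversal.
Proof.
have quarter : 4^-1 * (pi *+ 2) = pi / 2 :> R by rewrite -mulr_natr; field.
have half : 2^-1 * (pi *+ 2) = pi :> R by rewrite -mulr_natr; field.
have threeq : 3 / 4 * (pi *+ 2) = pi + pi / 2 :> R by rewrite -mulr_natr; field.
exists (fun i => (i : nat)%:R / 4); split.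
- move=> i; rewrite /double_segment /double_segment_traversal; congr (_ *: e).
  have [->|->|->|->] := ord4P i.
  + by rewrite !mul0r cos0 subrr.
  + by rewrite mul1r quarter cos_pihalf subr0.
  + have -> : (2%:R / 4 : R) = 2^-1 by field.
    by rewrite half cospi opprK.
  + by rewrite threeq (addrC pi) cosDpi cos_pihalf oppr0 subr0.
- by move=> i j ij; rewrite ler_pM2r// ler_nat.
- move=> i j; have : (j : nat)%:R < 4 :> R by rewrite ltr_nat.
  by have : 0 <= (i : nat)%:R :> R by []; lra.
Qed.

Lemma double_segment_straight_arc : @double_straight_arc R 2 double_segment.
Proof.
split; [|exact: double_segment_collinear|].
  split; first exact: double_segment_unit_edges.
  exists double_segment_traversal; split; last exact: double_segment_cyclic_order.
  split; first by have := double_segment_collinear.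
  by move=> _; exact: double_segment_forth_and_back.
exists (0 : 'I_4), (2 : 'I_4); apply: dist_eq => //.
by have [-> _ -> _] := double_segmentE; rewrite sub0r dotNl dotNr dotZl dotZr e1; ring.
Qed.

End DoubleSegment.

Lemma double_straight_arc_exists (R : realType) :
  exists A : 'I_4 -> 'rV[R]_2, @double_straight_arc R 2 A.
Proof.
have e1 : dot (delta_mx 0 0 : 'rV[R]_2) (delta_mx 0 0) = 1.
  by rewrite /dot !mxE /=; ring.
by exists (double_segment (delta_mx 0 0)); exact: double_segment_straight_arc.
Qed.

(** Vertices at distance 2 must be opposite, since edges have length 1; as the squared diagonals add
    up to 4, the other diagonal vanishes. *)
Lemma energy_double_straight_arc (R : realType) (alpha : R) (A : 'I_4 -> 'rV[R]_2) :
  @double_straight_arc R 2 A ->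
  (f_energy alpha (dist (A 0%R) (A 2%R)) + f_energy alpha (dist (A 1%R) (A 3%R)) =
   f_energy alpha 2 + f_energy alpha 0)%E.
Proof.
move=> [cA _ [i [j dij]]]; change (@convex_unit_polygon R 4 A) in cA.
have d4 := convex_unit_polygon_diagonals cA.
have [uA _] := cA; have [s0 s1 s2 s3] := ordS4.
have := dist_ge0 (A 0) (A 2); have := dist_ge0 (A 1) (A 3) => d13 d02.
have two : dist (A 0) (A 2) = 2 \/ dist (A 1) (A 3) = 2.
  have := uA 0; have := uA 1; have := uA 2; have := uA 3; rewrite s0 s1 s2 s3.
  move: dij; case: (ord4P i) => ->; case: (ord4P j) => ->;
    rewrite ?distxx ?(distC (A 3)) ?(distC (A 2) (A 1)) ?(distC (A 2) (A 0)) ?(distC (A 1) (A 0));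
    by [left|right|lra].
case: two => d.
  have -> : dist (A 1) (A 3) = 0 by rewrite d in d4; nra.
  by rewrite d.
have -> : dist (A 0) (A 2) = 0 by rewrite d in d4; nra.
by rewrite d addeC.
Qed.

(** * Comparison of energies in the three ranges of [alpha] *)

Theorem proposition4p3 (R : realType) (alpha : R) :
  [/\ alpha < 2 -> reaches_max_at (@energy R alpha 4) (@unit_square R),
      2 < alpha -> reaches_max_at (@energy R alpha 4) (@double_straight_arc R 2) &
      alpha = 2 -> forall G H : 'I_4 -> 'rV[R]_2,
        convex_unit_polygon G -> convex_unit_polygon H ->
        energy alpha G = energy alpha H].
Proof.
split=> a2.
- split; first exact: unit_square_exists.
  move=> S sqS; split; first exact: square_convex.
  move=> G cG; have [uG _] := cG; have [uS _] := sqS.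
  rewrite (energy_unit_edges alpha uG).
  rewrite (energy_unit_edges alpha uS).
  apply: leeD2l.
  have [-> ->] := square_diagonals sqS.
  by apply: f_energy_diag_le_square (convex_unit_polygon_diagonals cG); rewrite ?dist_ge0.
- split; first exact: double_straight_arc_exists.
  move=> S dS; have cS : @convex_unit_polygon R 4 S by have [] := dS.
  split; first exact: cS.
  move=> G cG; have [uG _] := cG; have [uS _] := cS.
  rewrite (energy_unit_edges alpha uG).
  rewrite (energy_unit_edges alpha uS).
  apply: leeD2l.
  rewrite (energy_double_straight_arc alpha dS).
  apply: f_energy_diag_le_segment (convex_unit_polygon_diagonals cG); rewrite ?dist_ge0//.
  exact: ltW.
- move=> G H cG cH; have [uG _] := cG; have [uH _] := cH.
  rewrite (energy_unit_edges alpha uG) (energy_unit_edges alpha uH).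
  (* At exponent 2 the diagonal terms are the squared diagonals themselves. *)
  have fE (A : 'I_4 -> 'rV[R]_2) : convex_unit_polygon A ->
      (f_energy alpha (dist (A 0%R) (A 2%R)) +
       f_energy alpha (dist (A 1%R) (A 3%R)))%E = 4%:E.
    move=> /convex_unit_polygon_diagonals <-.
    by rewrite a2 !f_energy2 ?dist_ge0.
  by congr (_ + _)%E; exact: etrans (fE _ cG) (esym (fE _ cH)).
Qed.
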